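(* Let $T$ be a residually finite periodic semigroup. Then $T$ is monogenic subsemigroup separability preserving if and only if $T$ is a union of groups.
   Context: Semigroups are nonempty; $S\times T$ is the direct product with componentwise multiplication. For a semigroup $S$, $s\in S$ and $Y\subseteq S\setminus\{s\}$, we say $s$ can be separated from $Y$ if there exist a finite semigroup $P$ and a semigroup homomorphism $\phi:S\to P$ with $\phi(s)\notin\phi(Y)$. A semigroup $S$ is residually finite if every $s\in S$ can be separated from every singleton $\{y\}$ with $y\in S$, $y\neq s$; it is monogenic subsemigroup separable if every $s\in S$ can be separated from every monogenic subsemigroup $\langle u\rangle=\{u^n\mid n\geq 1\}$ ($u\in S$) with $s\notin\langle u\rangle$. A semigroup $T$ is monogenic subsemigroup separability preserving if for every monogenic subsemigroup separable semigroup $S$, the direct product $S\times T$ is monogenic subsemigroup separable. A semigroup is periodic if each of its monogenic subsemigroups is finite. A semigroup is a union of groups if each of its elements lies in a subgroup, i.e. in a subsemigroup which is a group under the induced multiplication. *)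

(* Defs.v *)
From HB Require Import structures.
From mathcomp Require Import all_boot all_classical.
Set Implicit Arguments.
Unset Strict Implicit.
Unset Printing Implicit Defensive.

Local Open Scope classical_set_scope.
Local Open Scope group_scope.

(* [semigroupType] allows an empty carrier, so nonemptiness is required
   separately, as [[set: S] !=set0], wherever it is not implied: a homomorphism
   out of a nonempty semigroup has a nonempty target. Its [choiceType] component
   is no restriction, every type being a [choiceType] by the axioms of
   [mathcomp.classical.boolp]. *)

(* [sgpow u n] is the product of n copies of u for n >= 1; [sgpow u 0] is a
   junk value, equal to u. [natexp] would require a unit. *)
Definition sgpow (S : semigroupType) (u : S) (n : nat) : S :=
  iterop n *%g u u.

Definition monogenic (S : semigroupType) (u : S) : set S :=
  [set x | exists2 n : nat, (1 <= n)%N & x = sgpow u n].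

Definition separable_from (S : semigroupType) (s : S) (Y : set S) : Prop :=
  exists (P : semigroupType) (phi : {multiplicative S -> P}),
    finite_set [set: P] /\ ~ (phi @` Y) (phi s).

Definition residually_finite (S : semigroupType) : Prop :=
  forall s y : S, y <> s -> separable_from s [set y].

Definition monogenic_separable (S : semigroupType) : Prop :=
  forall s u : S, ~ monogenic u s -> separable_from s (monogenic u).

Definition monogenic_separability_preserving (T : semigroupType) : Prop :=
  forall S : semigroupType, [set: S] !=set0 ->
    monogenic_separable S -> monogenic_separable (S * T)%type.

Definition periodic (S : semigroupType) : Prop :=
  forall u : S, finite_set (monogenic u).

Definition is_subgroup (S : semigroupType) (G : set S) : Prop :=
  (forall x y, G x -> G y -> G (x * y)) /\
  exists e, [/\ G e,
    forall x, G x -> e * x = x /\ x * e = x &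
    forall x, G x -> exists y, [/\ G y, x * y = e & y * x = e]].

Definition union_of_groups (S : semigroupType) : Prop :=
  forall x : S, exists2 G : set S, is_subgroup G & G x.

(* Main.v *)
From HB Require Import structures.
Require Import Defs.
From mathcomp Require Import all_boot all_order all_algebra cyclic all_classical.
From mathcomp Require Import zify ring.

Local Open Scope classical_set_scope.

(** If [T] is a union of groups, then the powers of [v] in [T] form a finite
    cyclic group, and separating [(u ^ j, t)] from the powers of [(u, v)] amounts
    to finding finite quotients of [S] in which [u ^ j] avoids the [u ^ k] with
    [k] outside the residue class of [j] modulo some [n]. When [u] has infinite
    order, for each prime power [q = p ^ e] exactly dividing [n], a quotient
    separating [u ^ (j * q)] from the powers of [u ^ (j * q * p)] does this
    modulo [q].

    Conversely, suppose that [v] lies in no subgroup of [T]. It suffices to have a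
    monogenic subsemigroup separable [S] containing an element [u] of infinite
    order with [u \in S * u * u * S]: in every finite quotient such a [u] generates
    a group, so that [(u, v ^ (1 + r))] cannot be separated from the powers of
    [(u, v)] when [r] is a large multiple of the period of [v]. For [S] we take
    the affine maps [w |-> E ^ i * w + b] of [Z ^ 2], with [E] a hyperbolic
    integer matrix and [b] in an open half-plane preserved by [E]. Its elements
    lie in a polycyclic group, in which cyclic subgroups are closed in the
    profinite topology, while the half-plane condition keeps the identity out of
    [S], which turns closed cyclic subgroups into closed monogenic subsemigroups. *)

Set Implicit Arguments.
Unset Strict Implicit.
Unset Printing Implicit Defensive.

(** * Powers in a semigroup and their eventual periodicity *)

Section Powers.
Local Open Scope group_scope.
Variable S : semigroupType.
Implicit Types u x y : S.

Lemma sgpowS u n : 0 < n -> sgpow u n.+1 = u * sgpow u n.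
Proof. by case: n. Qed.

Lemma sgpowD u m n : 0 < m -> 0 < n -> sgpow u (m + n) = sgpow u m * sgpow u n.
Proof.
case: m => // m _ n_gt0; elim: m => [|m IHm]; first by rewrite add1n sgpowS.
by rewrite addSn sgpowS ?addSn // -addSn IHm mulgA.
Qed.

Lemma sgpowSr u n : 0 < n -> sgpow u n.+1 = sgpow u n * u.
Proof. by move=> n_gt0; rewrite -addn1 sgpowD. Qed.

Lemma sgpowM u m n : 0 < m -> 0 < n -> sgpow (sgpow u m) n = sgpow u (m * n).
Proof.
move=> m_gt0; case: n => // n _; elim: n => [|n IHn]; first by rewrite muln1.
by rewrite sgpowS // IHn -sgpowD ?muln_gt0 ?m_gt0 // -mulnS.
Qed.

Lemma sgpow_periodD u m e k a :
    0 < m -> sgpow u (m + e) = sgpow u m -> m <= a ->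
  sgpow u (a + k * e) = sgpow u a.
Proof.
move=> m_gt0 per le_ma.
have step b : m <= b -> sgpow u (b + e) = sgpow u b.
  rewrite leq_eqVlt => /predU1P[<- //|lt_mb].
  have -> : b = m + (b - m) by rewrite subnKC // ltnW.
  rewrite addnAC !(sgpowD _ _ (n := b - m)) ?subn_gt0 ?per //.
  exact: leq_trans m_gt0 (leq_addr _ _).
elim: k => [|k IHk]; first by rewrite addn0.
by rewrite mulSn addnCA addnA [e + a]addnC addnAC step // (leq_trans le_ma) ?leq_addr.
Qed.

Lemma sgpow_period_mod u m e a b :
    0 < m -> sgpow u (m + e) = sgpow u m -> m <= a -> m <= b ->
  a = b %[mod e] -> sgpow u a = sgpow u b.
Proof.
move=> m_gt0 per.
wlog le_ba : a b / b <= a => [ih|] le_ma le_mb.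
  by case/orP: (leq_total a b) => le eq; [symmetry|]; apply: ih.
move/eqP; rewrite eqn_mod_dvd // => /dvdnP[k eq_k].
by rewrite -(subnKC le_ba) eq_k (sgpow_periodD _ m_gt0).
Qed.

Lemma finite_monogenic u m e :
  0 < m -> 0 < e -> sgpow u (m + e) = sgpow u m -> finite_set (monogenic u).
Proof.
move=> m_gt0 e_gt0 per; apply/finite_seqP.
exists [seq sgpow u k | k <- iota 1 (m + e)].
apply/seteqP; split=> x /=; last first.
  case/mapP=> k; rewrite mem_iota => /andP[k_gt0 _] ->; by exists k.
case=> n n_gt0 ->; case: (leqP m n) => [le_mn|lt_nm]; last first.
  by apply: map_f; rewrite mem_iota n_gt0 add1n ltnS ltnW // (leq_trans lt_nm) ?leq_addr.
have -> : sgpow u n = sgpow u (m + (n - m) %% e).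
  apply: (sgpow_period_mod m_gt0 per) => //; first exact: leq_addr.
  by rewrite modnDmr subnKC.
apply: map_f; rewrite mem_iota add1n ltnS (leq_trans m_gt0) ?leq_addr //=.
by rewrite leq_add2l ltnW // ltn_pmod.
Qed.

Lemma sgpow_period_finite u : finite_set (monogenic u) ->
  exists m e, [/\ 0 < m, 0 < e & sgpow u (m + e) = sgpow u m].
Proof.
move=> fin; apply: contrapT => noper; apply: infinite_nat.
have injf : injective (fun n => sgpow u n.+1).
  have ne a b : a < b -> sgpow u a.+1 <> sgpow u b.+1.
    move=> lt_ab eq; apply: noper; exists a.+1, (b - a); split=> //.
      by rewrite subn_gt0.
    by rewrite addSn subnKC // ltnW.
  move=> a b eq; by case: (ltngtP a b) => // /ne; [case | case; exact: esym].
apply: (@sub_finite_set _ _ ((fun n => sgpow u n.+1) @^-1` monogenic u)).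
  by move=> n _; exists n.+1.
by apply: finite_preimage => // a b _ _; exact: injf.
Qed.

(* The inverse of [u ^ k] is [u ^ (k * (2 * n - 1))]: the exponents add up to a
   multiple of [n] while staying positive. *)
Lemma is_subgroup_monogenic u n : 0 < n -> sgpow u (1 + n) = u ->
  is_subgroup (monogenic u).
Proof.
move=> n_gt0 per; have pmod a b : 0 < a -> 0 < b -> a = b %[mod n] ->
  sgpow u a = sgpow u b by apply: sgpow_period_mod.
split=> [_ _ [a a_gt0 ->] [b b_gt0 ->]|].
  by exists (a + b); rewrite ?sgpowD ?addn_gt0 ?a_gt0.
exists (sgpow u n); split=> [|_ [a a_gt0 ->]|_ [a a_gt0 ->]]; first by exists n.
  by rewrite -!sgpowD //; split; apply: pmod;
    rewrite ?addn_gt0 ?a_gt0 ?n_gt0 ?modnDl ?modnDr.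
have b_gt0 : 0 < a * (2 * n).-1.
  by rewrite muln_gt0 a_gt0; case: (n) n_gt0 => // k _; rewrite mulnS.
exists (sgpow u (a * (2 * n).-1)); split; first by exists (a * (2 * n).-1)%N.
- rewrite -sgpowD //; apply: pmod; rewrite ?addn_gt0 ?a_gt0 //.
  by rewrite -mulnS prednK ?muln_gt0 // mulnA modnMl modnn.
- rewrite -sgpowD //; apply: pmod; rewrite ?addn_gt0 ?b_gt0 //.
  by rewrite addnC -mulnS prednK ?muln_gt0 // mulnA modnMl modnn.
Qed.

Lemma is_subgroup_sgpow (G : set S) u n :
  is_subgroup G -> G u -> 0 < n -> G (sgpow u n).
Proof.
move=> [GM _] Gu; case: n => // n _; elim: n => [//|n IHn].
by rewrite sgpowS //; apply: GM.
Qed.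

(** Multiplying by the inverse [v] of [u] removes one factor [u] from both sides of the periodicity
    relation, so the preperiod [m] drops to 1. *)
Lemma is_subgroup_period (G : set S) u : is_subgroup G -> G u ->
  finite_set (monogenic u) -> exists2 n, 0 < n & sgpow u (1 + n) = u.
Proof.
move=> sG Gu /sgpow_period_finite[m [e [m_gt0 e_gt0 per]]].
exists e => //; case: (sG) => _ [f [_ f1 inv]].
have [v [_ uv _]] := inv _ Gu.
case: m m_gt0 per => // m _; elim: m => [//|m IHm] per; apply: IHm.
have Gp k : G (sgpow u k.+1) by exact: is_subgroup_sgpow sG Gu _.
move: per => /(congr1 ( *%g ^~ v)); rewrite addSn !(sgpowSr u (n := _.+1)) // -!mulgA uv.
by rewrite addSn !(f1 _ (Gp _)).2.
Qed.

End Powers.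

Lemma gmulf_sgpow (S S' : semigroupType) (f : {multiplicative S -> S'}) u n :
  f (sgpow u n) = sgpow (f u) n.
Proof.
case: n => // n; elim: n => [//|n IHn].
by rewrite [LHS]/= gmulfM sgpowS // -IHn.
Qed.

Lemma sgpow_pair (S S' : semigroupType) (u : S) (v : S') n :
  sgpow (u, v) n = (sgpow u n, sgpow v n).
Proof.
rewrite [LHS]surjective_pairing.
by rewrite (gmulf_sgpow (@fst S S')) (gmulf_sgpow (@snd S S')).
Qed.

(** * Closure properties of separation *)

Section Separation.
Local Open Scope group_scope.
Variable S : semigroupType.
Implicit Types (s u x y : S) (Y Z : set S).

Lemma separable_from_sub s Y Z : Y `<=` Z -> separable_from s Z -> separable_from s Y.
Proof.
move=> YZ [P [phi [finP sep]]]; exists P, phi; split=> //.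
by move=> [y /YZ Zy eq]; apply: sep; exists y.
Qed.

Lemma separable_from_preimage (S' : semigroupType) (f : {multiplicative S -> S'})
    s (Y : set S') : separable_from (f s) Y -> separable_from s (f @^-1` Y).
Proof.
move=> [P [phi [finP sep]]].
exists P, (phi \o f); split=> //= -[y Yy eq]; apply: sep; by exists (f y).
Qed.

Let collapse : S -> 'I_1 := fun=> ord0.
Let collapseM : {morph collapse : x y / x * y}.
Proof. by move=> x y; rewrite [RHS]ord1. Qed.
HB.instance Definition _ := isMultiplicative.Build S 'I_1 collapse collapseM.

Lemma separable_from_set0 s : separable_from s set0.
Proof. by exists 'I_1, collapse; split; [exact: finite_finset|case]. Qed.

Lemma separable_fromU s Y Z :
  separable_from s Y -> separable_from s Z -> separable_from s (Y `|` Z).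
Proof.
move=> [P [f [finP sepY]]] [Q [g [finQ sepZ]]].
pose h x := (f x, g x).
have hM : {morph h : x y / x * y} by move=> x y; rewrite /h !gmulfM.
pose h' := HB.pack_for {multiplicative S -> (P * Q)%type} h
  (isMultiplicative.Build _ _ h hM).
exists (P * Q)%type, h'; split.
  by rewrite -setXTT; exact: finite_setX.
by move=> [y [Yy|Zy] [eqf eqg]]; [apply: sepY|apply: sepZ]; exists y.
Qed.

Lemma separable_from_bigcup (I : eqType) (r : seq I) (F : I -> set S) s :
  (forall i, i \in r -> separable_from s (F i)) ->
  separable_from s (\bigcup_(i in [set` r]) F i).
Proof.
elim: r => [|i r IHr] sep.
  by apply: separable_from_sub (separable_from_set0 s) => y [].
apply: (@separable_from_sub _ _ (F i `|` \bigcup_(j in [set` r]) F j)).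
  move=> y [j]; rewrite /= inE => /predU1P[->|jr] Fy; first by left.
  by right; exists j.
apply: separable_fromU; first by apply: sep; rewrite inE eqxx.
by apply: IHr => j jr; apply: sep; rewrite inE jr orbT.
Qed.

Lemma residually_finite_separable s Y :
  residually_finite S -> finite_set Y -> ~ Y s -> separable_from s Y.
Proof.
move=> rfS /finite_seqP[r ->] Ys.
have sep i : i \in r -> separable_from s [set i].
  by move=> ir; apply: rfS => eq_is; apply: Ys; rewrite -eq_is.
by apply: separable_from_sub (separable_from_bigcup sep) => y ry; exists y.
Qed.

(* If neither [s] nor [y] is a power of the other then one of them is separated
   from the powers of the other; otherwise both generate the same finite cyclic
   group, and separating [s * y^-1] from its identity separates [s] from [y]. *)
Lemma monogenic_separable_residually_finite :
  monogenic_separable S -> residually_finite S.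
Proof.
move=> sepS s y ne_ys.
have [[a a_gt0 eq_s]|nys] := pselect (monogenic y s); last first.
  by apply: separable_from_sub (sepS _ _ nys) => _ ->; exists 1%N.
have [[b b_gt0 eq_y]|nsy] := pselect (monogenic s y); last first.
  have [P [phi [finP sep]]] := sepS _ _ nsy; exists P, phi; split=> //.
  move=> [_ -> eq]; apply: sep; exists s => //; by exists 1%N.
have [n n_gt0 def_ab] : exists2 n, 0 < n & (a * b = 1 + n)%N.
  exists (a * b).-1; last by rewrite add1n prednK // muln_gt0 a_gt0.
  rewrite -ltnS prednK ?muln_gt0 ?a_gt0 // ltn_neqAle muln_gt0 a_gt0 b_gt0 !andbT.
  apply/eqP => /esym/eqP; rewrite muln_eq1 => /andP[/eqP a1 _].
  by apply: ne_ys; rewrite eq_s a1.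
have per : sgpow y (1 + n) = y by rewrite -def_ab -sgpowM // -eq_s.
have pmod c d : 0 < c -> 0 < d -> c = d %[mod n] ->
  sgpow y c = sgpow y d by apply: sgpow_period_mod.
have m_gt0 : 0 < (2 * n).-1.
  by case: (n) n_gt0 => // k _; rewrite mulnS.
pose inv := sgpow y (2 * n).-1.
have y_inv : y * inv = sgpow y n.
  by rewrite -sgpowS // prednK ?muln_gt0 //; apply: pmod; rewrite ?muln_gt0 ?modnMl ?modnn.
have [|P [phi [finP sep]]] := sepS (s * inv) (sgpow y n).
  case=> k k_gt0 eq; apply: ne_ys.
  have {}eq : s * inv = sgpow y n.
    rewrite eq sgpowM //; apply: pmod; rewrite ?muln_gt0 ?n_gt0 //.
    by rewrite modnMr modnn.
  move: eq => /(congr1 ( *%g ^~ y)).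
  rewrite -mulgA /inv -!sgpowSr // prednK ?muln_gt0 // eq_s -sgpowD ?muln_gt0 //.
  rewrite (pmod (a + _) a) ?addn_gt0 ?a_gt0 //; last by rewrite -modnDmr modnMl addn0.
  by move=> ->; rewrite -add1n per.
exists P, phi; split=> // -[_ -> eq]; apply: sep.
exists (sgpow y n); first by exists 1%N.
by rewrite gmulfM -eq -gmulfM y_inv.
Qed.

End Separation.


(** * Separating a power from powers with incongruent exponents *)

(** Write [d] as [d'] times a power of [p], with [d'] prime to [p]. That power divides [p ^ q], so
    [p * c = 1] modulo [d'] suffices, and Euler's theorem provides [c]. *)
Lemma prime_power_mul_mod p q d : prime p -> 0 < d -> ~~ (p ^ q %| d) ->
  exists2 c, 0 < c & p ^ q * (p * c) = p ^ q %[mod d].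
Proof.
move=> p_pr d_gt0; rewrite pfactor_dvdn // -ltnNge => lt_q.
have [d' cop def_d] := pfactor_coprime p_pr d_gt0.
have d'_gt0 : 0 < d' by move: d_gt0; rewrite def_d muln_gt0 => /andP[].
exists (p ^ (totient d').-1); first by rewrite expn_gt0 prime_gt0.
rewrite -expnS prednK ?totient_gt0 //.
apply/eqP; rewrite eqn_mod_dvd; last by rewrite leq_pmulr // expn_gt0 prime_gt0.
rewrite -[X in _ - X]muln1 -mulnBr {1}def_d mulnC dvdn_mul //.
  by rewrite dvdn_exp2l // ltnW.
rewrite -eqn_mod_dvd ?expn_gt0 ?prime_gt0 //; apply/eqP.
exact: Euler_exp_totient.
Qed.

(* A finite quotient separating [u ^ (j * p ^ e)] from the powers of
   [u ^ (j * p ^ e * p)] works: if [u ^ j] and [u ^ k] agree there and [p ^ e] does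
   not divide [k - j], then multiplication by [p] is invertible on [p ^ e] modulo
   the period [k - j]. *)
Lemma separable_from_incongruent (S : semigroupType) (u : S) j p e :
    monogenic_separable S -> prime p -> 0 < j ->
    (forall m l, 0 < m -> 0 < l -> sgpow u (m + l) <> sgpow u m) ->
  separable_from (sgpow u j)
    [set x | exists2 k, 0 < k & x = sgpow u k /\ k <> j %[mod p ^ e]].
Proof.
move=> sepS p_pr j_gt0 aper.
have a_gt0 : 0 < j * p ^ e by rewrite muln_gt0 j_gt0 expn_gt0 prime_gt0.
have p_gt0 := prime_gt0 p_pr.
have [|P [phi [finP sep]]] := sepS (sgpow u (j * p ^ e)) (sgpow u (j * p ^ e * p)).
  case=> c c_gt0; rewrite sgpowM ?(muln_gt0 _ p, a_gt0) // => eq.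
  apply: (aper _ (j * p ^ e * p * c - j * p ^ e) a_gt0).
    rewrite subn_gt0 -mulnA ltn_Pmulr // (leq_trans (prime_gt1 p_pr)) //.
    by rewrite leq_pmulr.
  by rewrite subnKC // -[leqRHS]mulnA leq_pmulr // muln_gt0 p_gt0.
exists P, phi; split=> // -[_ [k k_gt0 [-> ne_kj]] eq]; apply: sep.
have {}eq : sgpow (phi u) k = sgpow (phi u) j by rewrite -!gmulf_sgpow.
have [m [d [m_gt0 d_gt0 ndvd per le_mj]]] : exists m d, [/\ 0 < m, 0 < d,
    ~~ (p ^ e %| d), sgpow (phi u) (m + d) = sgpow (phi u) m & m <= j].
  case: (ltngtP k j) => [lt_kj|lt_jk|eq_kj]; last by case: ne_kj; rewrite eq_kj.
  - exists k, (j - k); split; rewrite ?subn_gt0 ?subnKC ?(ltnW lt_kj) //.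
    by rewrite -eqn_mod_dvd ?(ltnW lt_kj) //; apply/eqP/nesym.
  - exists j, (k - j); split; rewrite ?subn_gt0 ?subnKC ?(ltnW lt_jk) //.
    by rewrite -eqn_mod_dvd ?(ltnW lt_jk) //; apply/eqP.
have [c c_gt0 eq_c] := prime_power_mul_mod p_pr d_gt0 ndvd.
have le_ja : j <= j * p ^ e by rewrite leq_pmulr // expn_gt0 p_gt0.
exists (sgpow u (j * p ^ e * p * c)); first by exists c; rewrite ?sgpowM // muln_gt0 a_gt0.
rewrite !gmulf_sgpow; apply: sgpow_period_mod per _ _ _ => //.
- apply: leq_trans le_mj (leq_trans le_ja _).
  by rewrite -mulnA leq_pmulr // muln_gt0 p_gt0.
- exact: leq_trans le_ja.
- by rewrite -!mulnA -modnMmr eq_c modnMmr.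
Qed.

(** When [u] has finitely many powers, residual finiteness is enough. Otherwise incongruence modulo
    [n] entails incongruence modulo the exact power of some prime divisor of [n], which covers [Y]
    by finitely many sets separable from [u ^ j]. *)
Lemma separable_from_other_residues (S : semigroupType) (u : S) j n (Y : set S) :
    monogenic_separable S -> 0 < j -> 0 < n -> ~ Y (sgpow u j) ->
    Y `<=` [set x | exists2 k, 0 < k & x = sgpow u k /\ k <> j %[mod n]] ->
  separable_from (sgpow u j) Y.
Proof.
move=> sepS j_gt0 n_gt0 nY sub.
have [[m [e [m_gt0 e_gt0 per]]]|aper] := pselect (exists m e,
    [/\ 0 < m, 0 < e & sgpow u (m + e) = sgpow u m]).
  apply: residually_finite_separable => //.
    exact: monogenic_separable_residually_finite.
  apply: sub_finite_set (finite_monogenic m_gt0 e_gt0 per).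
  by move=> x /sub[k k_gt0 [-> _]]; exists k.
have sep p : p \in primes n -> separable_from (sgpow u j)
    [set x | exists2 k, 0 < k & x = sgpow u k /\ k <> j %[mod p ^ logn p n]].
  rewrite mem_primes => /and3P[p_pr _ _].
  apply: separable_from_incongruent => // m l m_gt0 l_gt0 eq.
  by apply: aper; exists m, l.
apply: separable_from_sub (separable_from_bigcup sep).
move=> _ /sub[k k_gt0 [-> ne]].
have [p p_in ne_p] : exists2 p, p \in primes n & k <> j %[mod p ^ logn p n].
  apply: contrapT => all_eq; apply: ne.
  have {}all_eq p : p \in \pi(n) -> k = j %[mod p ^ logn p n].
    by move=> p_in; apply: contrapT => ne; apply: all_eq; exists p.
  wlog le_jk : j k {j_gt0 k_gt0 sub sep nY} all_eq / j <= k => [ih|].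
    case/orP: (leq_total j k) => le; first exact: ih.
    by symmetry; apply: ih le => p /all_eq.
  apply/eqP; rewrite eqn_mod_dvd //; apply/dvdn_partP => // p /all_eq/eqP.
  by rewrite p_part eqn_mod_dvd.
by exists p => //; exists k.
Qed.

(** * Unions of groups preserve separability *)

Lemma union_of_groups_preserving (T : semigroupType) :
    residually_finite T -> periodic T -> union_of_groups T ->
  monogenic_separability_preserving T.
Proof.
move=> rfT perT grT S _ sepS [s t] [u v] not_pow.
have [vt|nvt] := pselect (monogenic v t); last first.
  apply: (@separable_from_sub _ _ _ (@snd S T @^-1` monogenic v)).
    by move=> _ [k k_gt0 ->]; rewrite sgpow_pair; exists k.
  exact/separable_from_preimage/residually_finite_separable.
have [us|nus] := pselect (monogenic u s); last first.
  apply: (@separable_from_sub _ _ _ (@fst S T @^-1` monogenic u)).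
    by move=> _ [k k_gt0 ->]; rewrite sgpow_pair; exists k.
  exact/separable_from_preimage/sepS.
have [j j_gt0 def_s] := us.
have [G sG Gv] := grT v; have [n n_gt0 per] := is_subgroup_period sG Gv (perT v).
pose Y := [set x | exists2 k, 0 < k & x = sgpow u k /\ sgpow v k = t].
(* A power of [(u, v)] has a second coordinate other than [t], or else its first coordinate lies in
   [Y]. *)
apply: (@separable_from_sub _ _ _ ((@snd S T @^-1` (monogenic v `\ t)) `|` (@fst S T @^-1` Y))).
  move=> _ [k k_gt0 ->]; rewrite sgpow_pair.
  have [eq|ne] := pselect (sgpow v k = t); [right|left].
    by exists k.
  by split; [exists k|].
apply: separable_fromU; apply: separable_from_preimage.
  apply: residually_finite_separable => //; last by case=> _; apply.
  exact: sub_finite_set (perT v).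
have nY : ~ Y s.
  by case=> k k_gt0 [eq_s eq_t]; apply: not_pow; exists k; rewrite // sgpow_pair -eq_s eq_t.
rewrite /= def_s in nY *; apply: (separable_from_other_residues sepS j_gt0 n_gt0) => //.
move=> _ [k k_gt0 [-> eq_t]]; exists k => //; split=> // eq_kj; apply: not_pow.
exists j => //; rewrite sgpow_pair -def_s -eq_t; congr pair.
by apply: sgpow_period_mod per _ _ _.
Qed.

(** * Affine maps and their congruence quotients *)

Import Order.TTheory GRing.Theory Num.Theory.
Local Open Scope ring_scope.

(** A triple [(i, A, b)] is the map [w |-> A * w + b] with a degree [i]. In [paff] the degree
    determines [A]; storing it lets degrees and entries be reduced by different moduli. *)
Definition aff (Z : zmodType) (R : nzRingType) : Type := (Z * 'M[R]_2 * 'cV[R]_2)%type.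

Section AffineSemigroup.
Variables (Z : zmodType) (R : nzRingType).
Implicit Types x y : aff Z R.

HB.instance Definition _ := Choice.on (aff Z R).

Definition aff_mul x y : aff Z R :=
  (x.1.1 + y.1.1, x.1.2 *m y.1.2, x.2 + x.1.2 *m y.2).

Lemma aff_mulA : associative aff_mul.
Proof. by move=> x y z; rewrite /aff_mul /= addrA !mulmxA mulmxDr addrA mulmxA. Qed.

HB.instance Definition _ := isSemigroup.Build (aff Z R) aff_mulA.

Lemma aff_mulE x y :
  (x * y)%g = (x.1.1 + y.1.1, x.1.2 *m y.1.2, x.2 + x.1.2 *m y.2).
Proof. by []. Qed.

Lemma aff_sgpow_degree x n : (0 < n)%N -> (sgpow x n).1.1 = x.1.1 *+ n.
Proof.
case: n => // n _; elim: n => [//|n IHn].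
by rewrite sgpowS // aff_mulE [LHS]/= IHn -mulrS.
Qed.

Lemma aff_sgpow_translation c n : (0 < n)%N ->
  sgpow ((0, 1%:M, c) : aff Z R) n = (0, 1%:M, c *+ n).
Proof.
case: n => // n _; elim: n => [//|n IHn].
by rewrite sgpowS // IHn aff_mulE /= addr0 !mul1mx -mulrS.
Qed.

End AffineSemigroup.

Lemma eq_intr_Zp (N : nat) (a b : int) : (1 < N)%N ->
  (a%:~R == b%:~R :> 'Z_N) = (N %| a - b)%Z.
Proof.
move=> N_gt1; rewrite -subr_eq0 -rmorphB /=.
wlog [n ->] : a b / exists n : nat, a - b = n => [ih|].
  case: (leP 0 (a - b)) => [ge0|lt0]; first by apply: ih; exists `|a - b|%N; lia.
  have := ih b a; rewrite -[a - b]opprB rmorphN oppr_eq0 rpredN => -> //.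
  by exists `|b - a|%N; lia.
rewrite -pmulrn; apply/eqP/idP => [/(congr1 val)|].
  by rewrite /= val_Zp_nat //= => /eqP.
by rewrite dvdzE /= => /dvdnP[k ->]; rewrite natrM pchar_Zp // mulr0.
Qed.

Section Reduction.
Variables M N : nat.

Definition aff_red (x : aff int int) : aff 'Z_M 'Z_N :=
  (x.1.1%:~R, map_mx intr x.1.2, map_mx intr x.2).

Lemma aff_redM : {morph aff_red : x y / (x * y)%g}.
Proof.
move=> x y; rewrite !aff_mulE /aff_red /=.
by rewrite rmorphD map_mxD !map_mxM.
Qed.

HB.instance Definition _ := isMultiplicative.Build _ _ aff_red aff_redM.

Lemma aff_red_mulIg (z x y : aff int int) : x.1.2 = y.1.2 ->
    aff_red (x * z)%g = aff_red (y * z)%g ->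
  map_mx intr x.2 = map_mx intr y.2 :> 'cV['Z_N]_2.
Proof.
rewrite !aff_mulE => -> /(congr1 (fun a : aff 'Z_M 'Z_N => a.2)) /=.
by rewrite !map_mxD => /addIr.
Qed.

Lemma finite_aff_Zp : finite_set [set: aff 'Z_M 'Z_N].
Proof. exact: (@finite_finset ('Z_M * 'M['Z_N]_2 * 'cV['Z_N]_2)%type). Qed.

End Reduction.

(** A nonzero coordinate [c i 0] fixes the only candidate [n]. Modulo a multiple of [c i 0 * L], any
    multiplier is congruent to [n] modulo [L]; as [L] exceeds the size of the error
    [b k 0 - n * c k 0], that error vanishes. *)
Lemma col_scale_of_mod (m : nat) (b c : 'cV[int]_m) : c != 0 ->
    (forall N, (1 < N)%N ->
      exists n, map_mx intr b = map_mx intr (c *+ n) :> 'cV['Z_N]_m) ->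
  exists n : int, b = n *: c.
Proof.
case/cV0Pn=> i ci modN.
have modE N : (1 < N)%N -> exists n : int, forall k, (N %| (b k 0 - c k 0 * n)%R)%Z.
  move=> N_gt1; have [n /colP eq] := modN N N_gt1; exists n => k.
  have := eq k; rewrite !mxE => /eqP; rewrite eq_intr_Zp //.
  by rewrite mulmxnE -mulr_natr natz.
have ci_gt0 : (0 < `|(c i 0)%R|)%N by rewrite absz_gt0.
have /dvdzP[n bi] : ((c i 0)%R %| (b i 0)%R)%Z.
  (* The factor 2 keeps the modulus above 1, where ['Z_N] is the ring of integers modulo [N]. *)
  have [|n0 dv] := modE (`|(c i 0)%R| * 2)%N; first by move: ci_gt0; case: absz.
  rewrite -(subrK (c i 0 * n0) (b i 0)) rpredD ?dvdz_mulr //.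
  by apply: dvdz_trans (dv i); rewrite dvdzE /= dvdn_mulr.
exists n; apply/colP => k; rewrite mxE.
pose L := `|(b k 0 - n * c k 0)%R|.+1.
have [|n' dv] := modE (`|(c i 0)%R| * (L * 2))%N; first by move: ci_gt0; case: absz.
have dvL : (L * 2 %| n - n')%Z.
  have := dv i; rewrite bi mulrC -mulrBr.
  by rewrite !dvdzE abszM /= dvdn_pmul2l // absz_gt0.
have : (L %| (b k 0 - n * c k 0)%R)%Z.
  have -> : b k 0 - n * c k 0 = (b k 0 - c k 0 * n') - (n - n') * c k 0 by ring.
  rewrite rpredB ?dvdz_mulr //.
    by apply: dvdz_trans (dv k); rewrite dvdzE /= mulnCA dvdn_mulr.
  by apply: dvdz_trans dvL; rewrite dvdzE /= dvdn_mulr.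
rewrite dvdzE /= => dv_L; apply/eqP; rewrite -subr_eq0 -absz_eq0.
by apply: contraTT dv_L; rewrite -lt0n => gt0; rewrite gtnNdvd.
Qed.

Lemma ord2P (P : 'I_2 -> Prop) : P 0 -> P 1 -> forall i, P i.
Proof.
move=> P0 P1 [[|[|//]] lt_i].
  by rewrite (_ : Ordinal lt_i = 0) //; apply: val_inj.
by rewrite (_ : Ordinal lt_i = 1) //; apply: val_inj.
Qed.

(** * A hyperbolic matrix and its invariant half-plane *)

(** The rows are [(3, 1)] and [(1, 0)]: the determinant is -1 and the orthant is preserved. The
    entry 3 pays for the three translations by [c] in [paff_square_factor]. *)
Definition hyp_mx : 'M[int]_2 :=
  \matrix_(i < 2, j < 2) if j == 0 then (if i == 0 then 3 else 1) else (i == 0)%:R.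

Lemma hyp_mx_mulE (b : 'cV[int]_2) :
  (hyp_mx *m b) 0 0 = 3 * b 0 0 + b 1 0 /\ (hyp_mx *m b) 1 0 = b 0 0.
Proof.
rewrite !mxE !big_ord_recl !big_ord0 !mxE /= (_ : lift ord0 ord0 = 1); last exact: val_inj.
by rewrite !mul1r !addr0 mul0r addr0.
Qed.

Lemma hyp_mx_unit : hyp_mx \is a GRing.unit.
Proof.
pose inv : 'M[int]_2 := \matrix_(i < 2, j < 2)
  if i == 0 then (j != 0)%:R else if j == 0 then 1 else - 3.
suff /mulmx1_unit[] : hyp_mx *m inv = 1%:M by [].
apply/matrixP => i j; rewrite !mxE !big_ord_recl big_ord0 !mxE /=.
by case: i => [[|[|//]] ?]; case: j => [[|[|//]] ?].
Qed.

Definition nneg_cv (b : 'cV[int]_2) := [forall i, 0 <= b i 0].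

Lemma nneg_cvD b c : nneg_cv b -> nneg_cv c -> nneg_cv (b + c).
Proof.
move=> /forallP b_ge0 /forallP c_ge0; apply/forallP => i.
by rewrite mxE addr_ge0.
Qed.

Lemma nneg_cv_hyp_mx b n : nneg_cv b -> nneg_cv (hyp_mx ^+ n *m b).
Proof.
elim: n => [|n IHn] b_ge0; first by rewrite expr0 mul1mx.
rewrite exprS -mulmxA; have /forallP {IHn b_ge0} := IHn b_ge0.
move: (_ *m b) => c c_ge0; have [c0 c1] := hyp_mx_mulE c.
by apply/forallP => i; elim/ord2P: i; rewrite ?c0 ?c1 ?addr_ge0 ?mulr_ge0.
Qed.

(* The union of the preimages of the orthant under the powers of [hyp_mx] is an
   open half-plane bounded by an eigenline, whence its invariance under both
   [hyp_mx] and its inverse. *)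
Definition pos_cv (b : 'cV[int]_2) :=
  (b != 0) && `[< exists n, nneg_cv (hyp_mx ^+ n *m b) >].

Lemma pos_cvP b : reflect (b <> 0 /\ exists n, nneg_cv (hyp_mx ^+ n *m b)) (pos_cv b).
Proof.
by apply: (iffP andP) => -[/eqP b0 /asboolP].
Qed.

Lemma hyp_mx_inj n (b : 'cV[int]_2) : hyp_mx ^ n *m b = 0 -> b = 0.
Proof.
have u : hyp_mx ^ n \in unitmx by exact: (unitrXz n hyp_mx_unit).
move=> eq; by rewrite -(mulKmx u b) eq mulmx0.
Qed.

Lemma pos_cvD b c : pos_cv b -> pos_cv c -> pos_cv (b + c).
Proof.
move=> /pos_cvP[b0 [m bm]] /pos_cvP[c0 [n cn]].
have bmn : nneg_cv (hyp_mx ^+ (m + n) *m b).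
  by rewrite addnC exprD -mulmxA nneg_cv_hyp_mx.
have cmn : nneg_cv (hyp_mx ^+ (m + n) *m c).
  by rewrite exprD -mulmxA nneg_cv_hyp_mx.
apply/pos_cvP; split; last by exists (m + n)%N; rewrite mulmxDr nneg_cvD.
move=> /(congr1 (mulmx (hyp_mx ^+ (m + n)))); rewrite mulmxDr mulmx0 => eq.
apply: b0; apply: (@hyp_mx_inj (m + n)%N); apply/colP => i.
have := congr1 (fun v : 'cV_2 => v i 0) eq; rewrite !mxE /= => /eqP.
move: bmn cmn => /forallP/(_ i); rewrite mxE => h1 /forallP/(_ i); rewrite mxE => h2.
by rewrite paddr_eq0 // => /andP[/eqP].
Qed.

Lemma pos_cv_hyp_mx (n : int) b : pos_cv b -> pos_cv (hyp_mx ^ n *m b).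
Proof.
move=> /pos_cvP[b0 [m bm]]; apply/pos_cvP; split; first by move/hyp_mx_inj.
case: n => n.
  by exists m; rewrite mulmxA mulmxE -exprD addnC exprD -mulmxA nneg_cv_hyp_mx.
(* [Negz n] is [-(n.+1)], undone by [n.+1] more factors [hyp_mx]. *)
exists (m + n.+1)%N; rewrite mulmxA mulmxE exprD NegzE -exprnN mulrK //.
by rewrite unitrX // hyp_mx_unit.
Qed.

(** * Affine maps with translation part in the half-plane *)

Definition pos_aff (x : aff int int) := (x.1.2 == hyp_mx ^ x.1.1) && pos_cv x.2.

Lemma pos_affM : mulg_closed pos_aff.
Proof.
move=> x y /andP[/eqP ex px] /andP[/eqP ey py]; apply/andP; split=> /=.
  by rewrite ex ey mulmxE -exprzDr // hyp_mx_unit.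
by rewrite ex pos_cvD ?pos_cv_hyp_mx.
Qed.

Definition paff := {x | pos_aff x}.

HB.instance Definition _ := SubChoice.on paff.
HB.instance Definition _ :=
  SubChoice_isSubSemigroup.Build (aff int int) pos_aff paff pos_affM.

Definition paff_val : paff -> aff int int := val.

Lemma paff_valM : {morph paff_val : x y / (x * y)%g}.
Proof. exact: valM. Qed.

HB.instance Definition _ := isMultiplicative.Build paff (aff int int) paff_val paff_valM.

Lemma paff_val_inj : injective paff_val.
Proof. exact: val_inj. Qed.

Lemma paff_val_sgpow x n : paff_val (sgpow x n) = sgpow (paff_val x) n.
Proof. exact: gmulf_sgpow. Qed.

Lemma aff_red_sgpow M N x n :
  sgpow (aff_red M N (paff_val x)) n = aff_red M N (paff_val (sgpow x n)).
Proof. by rewrite -!gmulf_sgpow. Qed.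

Implicit Types s x y z : paff.

Lemma paff_linear s : (paff_val s).1.2 = hyp_mx ^ (paff_val s).1.1.
Proof. by case: s => -[[i A] b] /= /andP[/eqP]. Qed.

Lemma paff_pos s : pos_cv (paff_val s).2.
Proof. by case: s => -[[i A] b] /= /andP[]. Qed.

Lemma paff_eq s y : (paff_val s).1.1 = (paff_val y).1.1 -> (paff_val s).2 = (paff_val y).2 -> s = y.
Proof.
move=> eq1 eq2; apply: paff_val_inj; move: (paff_linear s) (paff_linear y) eq1 eq2.
by case: (paff_val s) (paff_val y) => [[i A] b] [[j B] c] /= -> -> -> ->.
Qed.

Lemma paff_mulIg z s y : (s * z)%g = (y * z)%g -> s = y.
Proof.
move=> /(congr1 paff_val); rewrite !paff_valM !aff_mulE => -[/addIr eq1 _].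
by rewrite !paff_linear eq1 => /addIr; apply: paff_eq.
Qed.

(** Equality would make [s] the identity map, whose translation part 0 is not in the half-plane.
    This is what rules out negative exponents below. *)
Lemma paff_mul_neq s y : (s * y)%g <> y.
Proof.
move=> /(congr1 paff_val); rewrite !paff_valM aff_mulE.
move=> /(congr1 (fun a : aff int int => (a.1.1, a.2))) /= [eq1].
have i0 : (paff_val s).1.1 = 0 by apply: (addIr (paff_val y).1.1); rewrite add0r.
rewrite paff_linear i0 expr0z mul1mx => eq2.
have /pos_cvP[+ _] := paff_pos s; apply.
by apply: (addIr (paff_val y).2); rewrite add0r.
Qed.

(** * Detecting powers of [x] in congruence quotients *)

Section Separability.
Variables s x : paff.

Hypothesis nsep : forall M N : nat, (1 < M)%N -> (1 < N)%N ->
  exists2 l, (0 < l)%N & aff_red M N (paff_val s) = sgpow (aff_red M N (paff_val x)) l.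

Let i := (paff_val s).1.1.
Let j := (paff_val x).1.1.

Lemma degree_mod (M N l : nat) : (1 < M)%N -> (0 < l)%N ->
  aff_red M N (paff_val s) = sgpow (aff_red M N (paff_val x)) l -> (M %| i - j * l%:Z)%Z.
Proof.
move=> M_gt1 l_gt0 /(congr1 (fun a : aff 'Z_M 'Z_N => a.1.1)) /=.
rewrite aff_sgpow_degree // => eq; rewrite -eq_intr_Zp // eq.
by rewrite /= -mulr_natr intrM.
Qed.

(** One modulus suffices: one above the size of [i] when [j = 0], and otherwise a multiple of
    [j]. *)
Lemma degree_dvd : exists k : int, i = j * k.
Proof.
have [j0|j0] := eqVneq j 0.
  exists 0; rewrite mulr0; have [//|//|l l_gt0] := @nsep `|i|.+2 2.
  move/degree_mod; rewrite j0 mul0r subr0 dvdzE /= => /(_ isT l_gt0) dv.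
  apply/eqP; rewrite -absz_eq0; apply: contraTT dv.
  by rewrite -lt0n => gt0; rewrite gtnNdvd // ltnS.
have M_gt1 : (1 < `|j| * 2)%N by rewrite -absz_gt0 in j0; move: j0; case: absz.
have [||l l_gt0] := @nsep (`|j| * 2) 2 => //.
move=> /(degree_mod M_gt1 l_gt0) dv; suff /dvdzP[k eq] : (j %| i)%Z.
  by exists k; rewrite mulrC.
rewrite -(subrK (j * l) i) rpredD ?dvdz_mulr //.
by apply: dvdz_trans dv; rewrite dvdzE /= dvdn_mulr.
Qed.

Lemma monogenic_translation : j = 0 -> i = 0 -> monogenic x s.
Proof.
move=> j0 i0.
have def_x : paff_val x = (0, 1%:M, (paff_val x).2).
  by move: (paff_linear x) j0; rewrite /j; case: (paff_val x) => [[? ?] ?] /= -> ->.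
have [||n eq_b] := @col_scale_of_mod _ (paff_val s).2 (paff_val x).2.
- by have /pos_cvP[/eqP] := paff_pos x.
- move=> N N_gt1; have [//|//|l l_gt0] := @nsep 2 N.
  rewrite -gmulf_sgpow def_x aff_sgpow_translation // => eq.
  exists l; exact: (congr1 (fun a : aff 'Z_2 'Z_N => a.2) eq).
case: n eq_b => [n|n] eq_b.
  have n_gt0 : (0 < n)%N.
    rewrite lt0n; apply/eqP => n0; have /pos_cvP[+ _] := paff_pos s; apply.
    by rewrite eq_b n0 scale0r.
  exists n => //; apply: paff_val_inj; rewrite paff_val_sgpow def_x aff_sgpow_translation //.
  move: (paff_linear s) i0 eq_b; rewrite /i; case: (paff_val s) => [[? ?] ?] /= -> -> ->.
  by rewrite expr0z -scaler_nat natz.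
(* Here [s] acts as [x ^ -(n.+1)], so [s * x ^ n.+1] would fix [x]. The extra factor [x] avoids an
   empty power. *)
suff: (s * sgpow x n.+2)%g = x by rewrite sgpowSr // mulgA => /paff_mul_neq.
have s_deg : (paff_val s).1.1 = 0 by [].
apply: paff_eq; rewrite paff_valM aff_mulE paff_val_sgpow def_x aff_sgpow_translation //=.
  by rewrite s_deg addr0.
rewrite paff_linear s_deg expr0z mul1mx eq_b -scaler_nat -scalerDl natz.
by rewrite (_ : _ + _ = 1) ?scale1r //; lia.
Qed.

(* Cancelling [m] copies of [x] in the linear group makes the two sides of the
   separation differ by a translation that does not depend on [m]. *)
Lemma monogenic_degree (k : int) : j != 0 -> i = j * k -> monogenic x s.
Proof.
move=> j0 def_i.
(* Since [k] may be zero or negative, [s = x ^ k] is replaced with [s * x ^ p = x ^ q] for positive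
   exponents. *)
have [p [q [p_gt0 q_gt0 def_q]]] :
    exists p q : nat, [/\ (0 < p)%N, (0 < q)%N & (q%:Z = p%:Z + k)%R].
  case: k {def_i} => n; first by exists 1%N, n.+1.
  by exists n.+2, 1%N; split=> //; rewrite NegzE; lia.
have deg : (paff_val (s * sgpow x p)%g).1.1 = (paff_val (sgpow x q)).1.1.
  rewrite paff_valM aff_mulE !paff_val_sgpow [LHS]/= !aff_sgpow_degree // -/i -/j def_i.
  by rewrite -[j *+ p]mulr_natr -[j *+ q]mulr_natr !natz def_q mulrDr addrC.
have [eq2|ne2] := eqVneq (paff_val (s * sgpow x p)%g).2 (paff_val (sgpow x q)).2.
  have eq : (s * sgpow x p)%g = sgpow x q by exact: paff_eq.
  case: (ltngtP p q) => [lt_pq|lt_qp|eq_pq].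
  - exists (q - p)%N; rewrite ?subn_gt0 //; apply: (@paff_mulIg (sgpow x p)).
    by rewrite eq -sgpowD ?subn_gt0 // subnK // ltnW.
  - case: (@paff_mul_neq (s * sgpow x (p - q))%g (sgpow x q)).
    by rewrite -mulgA -sgpowD ?subn_gt0 // subnK // ltnW.
  - by case: (@paff_mul_neq s (sgpow x p)); rewrite eq eq_pq.
have /cV0Pn[h] : (paff_val (s * sgpow x p)%g).2 - (paff_val (sgpow x q)).2 != 0.
  by rewrite subr_eq0.
set d := _ - _ => dh.
(* [N] exceeds the size of [d h 0], so [d] stays nonzero modulo [N]. *)
pose N := `|d h 0|.+2; pose y := aff_red 2 N (paff_val x).
have [m [e [m_gt0 e_gt0 per]]] : exists m e,
    [/\ (0 < m)%N, (0 < e)%N & sgpow y (m + e) = sgpow y m].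
  by apply: sgpow_period_finite; apply: sub_finite_set (@finite_aff_Zp 2 N).
(* Comparing degrees with this modulus gives [l = k] modulo [e]; the factor 2 carries the equality
   over to the modulus 2 used in [y]. *)
have M_gt1 : (1 < `|j| * e * 2)%N.
  by rewrite -absz_gt0 in j0; rewrite muln2 -addnn -addn1 leq_add ?muln_gt0 ?j0.
have [//|//|l l_gt0 eq_l] := @nsep (`|j| * e * 2) N.
have dv := degree_mod M_gt1 l_gt0 eq_l.
have eq_red : aff_red 2 N (paff_val s) = sgpow y l.
  move: eq_l; rewrite /y !aff_red_sgpow => eq_l.
  congr (_, _, _).
  - apply/eqP; rewrite eq_intr_Zp // paff_val_sgpow aff_sgpow_degree // -mulr_natr natz.
    by apply: dvdz_trans dv; rewrite dvdzE /= dvdn_mull.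
  - exact: (congr1 (fun a : aff 'Z_ _ 'Z_N => a.1.2) eq_l).
  - exact: (congr1 (fun a : aff 'Z_ _ 'Z_N => a.2) eq_l).
have eq_mod : (l + (p + m) = q + m %[mod e])%N.
  have dvk : (e %| k - l%:Z)%Z.
    move: dv; rewrite def_i -mulrBr dvdzE /= abszM -mulnA dvdn_pmul2l ?absz_gt0 //.
    exact: dvdn_trans (dvdn_mulr _ _).
  apply/eqP; rewrite -eqz_nat -!modz_nat eq_sym eqz_mod_dvd.
  by rewrite (_ : _ - _ = k - l%:Z) // !PoszD def_q; ring.
have : aff_red 2 N (paff_val (s * sgpow x p * sgpow x m)%g) =
       aff_red 2 N (paff_val (sgpow x q * sgpow x m)%g).
  rewrite !paff_valM !aff_redM -!aff_red_sgpow eq_red -/y.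
  rewrite -mulgA -!sgpowD ?addn_gt0 ?p_gt0 //.
  by apply: (sgpow_period_mod m_gt0 per) eq_mod; rewrite ?addnA leq_addl.
have lin : (paff_val (s * sgpow x p)%g).1.2 = (paff_val (sgpow x q)).1.2.
  by rewrite !paff_linear deg.
rewrite (paff_valM (_ * _)%g) (paff_valM (sgpow x q)).
move=> /(aff_red_mulIg lin)/eqP; rewrite -subr_eq0 -map_mxB -/d => /eqP/colP/(_ h)/eqP.
rewrite mxE [X in _ == X]mxE -(rmorph0 (intmul 1)) eq_intr_Zp // subr0 dvdzE /=.
by rewrite gtnNdvd ?absz_gt0 // /N ltnW.
Qed.

End Separability.

Lemma paff_monogenic_separable : monogenic_separable paff.
Proof.
move=> s x nsx; apply: contrapT => nsep; apply: nsx.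
have {}nsep M N : (1 < M)%N -> (1 < N)%N -> exists2 l, (0 < l)%N &
    aff_red M N (paff_val s) = sgpow (aff_red M N (paff_val x)) l.
  move=> _ _; apply: contrapT => no_l; apply: nsep.
  exists (aff 'Z_M 'Z_N), (aff_red M N \o paff_val); split.
    exact: finite_aff_Zp.
  move=> [_ [l l_gt0 ->] eq]; apply: no_l; exists l => //.
  by rewrite aff_red_sgpow; exact: esym eq.
have [k def_i] := degree_dvd nsep.
have [j0|j0] := eqVneq (paff_val x).1.1 0.
  by apply: monogenic_translation; rewrite // def_i j0 mul0r.
exact: monogenic_degree def_i.
Qed.

(** * Preservation forces a union of groups *)

Lemma paff_square_factor : exists u a b : paff,
  u = (a * u * u * b)%g /\ forall n, (0 < n)%N -> sgpow u n = u -> n = 1%N.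
Proof.
pose c : 'cV[int]_2 := delta_mx 0 0.
have c0 : c != 0 by apply/cV0Pn; exists 0; rewrite mxE.
have pos_c : pos_cv c.
  apply/pos_cvP; split; first exact/eqP.
  by exists 0; apply/forallP => i; rewrite expr0 mul1mx mxE ler0n.
have [c1 c2] := hyp_mx_mulE c.
(* Chosen so that [a + hyp_mx ^ (-1) *m (c *+ 3)] is [c]; the three copies of [c] come from the two
   factors [u] and from [b]. *)
pose a := c - hyp_mx ^ (-1) *m (c *+ 3).
have hyp_a : hyp_mx *m a = delta_mx 1 0.
  rewrite mulmxBr mulmxA mulmxE exprN1 divrr ?hyp_mx_unit // mul1mx.
  move: (hyp_mx *m c) c1 c2 => w w1 w2.
  by apply/colP; apply: ord2P; rewrite !(mxE, mulmxnE) ?w1 ?w2 !mxE.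
have pos_a : pos_cv a.
  apply/pos_cvP; split.
    move=> a0; move: hyp_a; rewrite a0 mulmx0 => /colP/(_ 1)/eqP.
    by rewrite !mxE.
  by exists 1%N; apply/forallP => i; rewrite expr1 hyp_a mxE ler0n.
have pos_u : pos_aff (0, 1%:M, c) by apply/andP; rewrite expr0z.
have pos_b : pos_aff (1, hyp_mx, c) by apply/andP; rewrite expr1z.
have pos_a' : pos_aff (-1, hyp_mx ^ (-1), a) by apply/andP.
exists (Sub _ pos_u), (Sub _ pos_a'), (Sub _ pos_b); split.
  apply: paff_eq; rewrite !paff_valM /= ?addr0 //.
  by rewrite !mulmx1 -!addrA -!mulmxDr -[c + (c + c)]/(c *+ 3) addNr addr0.
case=> // n _ /(congr1 (fun x => (paff_val x).2)).
rewrite paff_val_sgpow aff_sgpow_translation //= => /eqP.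
rewrite -subr_eq0 mulrSr addrK => /eqP/colP/(_ 0)/eqP.
by rewrite mulmxnE !mxE /= pnatr_eq0 => /eqP ->.
Qed.

Lemma sgpow_factor (S : semigroupType) (w c b : S) n : (0 < n)%N ->
  w = (c * w * b)%g -> w = (sgpow c n * w * sgpow b n)%g.
Proof.
case: n => // n _ eq; elim: n => [//|n IHn].
by rewrite [LHS]IHn {1}eq (@sgpowSr _ c n.+1) // (@sgpowS _ b n.+1) // !mulgA.
Qed.

(* Iterating [w = (a * w) * w * b] and using that the powers of [a * w] are
   eventually periodic gives [w = c * w * w]; iterating that on the other side
   gives the result. *)
Lemma finite_square_factor (P : semigroupType) (w a b : P) :
    finite_set [set: P] -> w = (a * w * w * b)%g ->
  exists2 k, (0 < k)%N & sgpow w (1 + k) = w.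
Proof.
move=> finP eq_w.
have period (x : P) : exists m e, [/\ (0 < m)%N, (0 < e)%N & sgpow x (m + e) = sgpow x m].
  by apply: sgpow_period_finite; apply: sub_finite_set finP.
have [c eq_c] : exists c, w = (c * w * w)%g.
  move def_x: (a * w)%g eq_w => x eq_w.
  have [m [e [m_gt0 e_gt0 per]]] := period x.
  have {}eq_w : w = (sgpow x e * w)%g.
    rewrite {2}(sgpow_factor m_gt0 eq_w) !mulgA -sgpowD // addnC per.
    exact: sgpow_factor.
  (* The witness is [x ^ (e - 1) * a], reduced to [a] when [e = 1] because [sgpow x 0] is not a
     unit. *)
  case: e {per} e_gt0 eq_w => // -[|e] _ eq.
    by exists a; rewrite def_x -eq.
  by exists (sgpow x e.+1 * a)%g; rewrite -mulgA -mulgA (mulgA a) def_x mulgA -sgpowSr.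
have [m [e [m_gt0 e_gt0 per]]] := period w.
exists e => //; rewrite sgpowD // {1}[sgpow w 1](sgpow_factor m_gt0 eq_c).
by rewrite -mulgA -sgpowD // per -sgpow_factor.
Qed.

Lemma preserving_union_of_groups (T : semigroupType) :
  periodic T -> monogenic_separability_preserving T -> union_of_groups T.
Proof.
move=> perT presT v; have [m [e [m_gt0 e_gt0 per]]] := sgpow_period_finite (perT v).
have pmod c d : (m <= c)%N -> (m <= d)%N -> c = d %[mod e] ->
  sgpow v c = sgpow v d by apply: sgpow_period_mod.
have em_gt0 : (0 < e * m)%N by rewrite muln_gt0 e_gt0.
have le_em : (m <= e * m)%N by rewrite leq_pmull.
suff per1 : sgpow v (1 + e * m) = v.
  by exists (monogenic v); [exact: is_subgroup_monogenic em_gt0 per1 | exists 1%N].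
have [u [a [b [eq_u aper]]]] := paff_square_factor.
(* As [u ^ n = u] only for [n = 1], this membership forces [v ^ (1 + e * m) = v]. *)
suff: monogenic (u, v) (u, sgpow v (1 + e * m)).
  move: (sgpow v _) => y [n n_gt0]; rewrite sgpow_pair => -[eq_un ->].
  by rewrite (aper n n_gt0 (esym eq_un)).
apply: contrapT => nmon.
have nonempty : [set: paff] !=set0 by exists u.
have [P [phi [finP sep]]] := presT _ nonempty paff_monogenic_separable _ _ nmon.
pose t := sgpow v (1 + e * m); rewrite -/t in nmon sep.
set w := (u, t) in nmon sep.
(* In the second coordinate, [(2 * e).-1] is -1 modulo [e] and compensates for the doubled [t]. *)
have eq_w : w = ((a, sgpow v (e * m)) * w * w * (b, sgpow v ((2 * e).-1 + e * m)))%g.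
  transitivity ((a * u * u * b)%g,
      (sgpow v (e * m) * t * t * sgpow v ((2 * e).-1 + e * m))%g); last by [].
  rewrite -eq_u -!sgpowD ?addn_gt0 ?em_gt0 ?orbT //; congr pair.
  have -> : (e * m + (1 + e * m) + (1 + e * m) + ((2 * e).-1 + e * m) =
             1 + e * m + e * (m * 3 + 2))%N by lia.
  have le_m : (m <= 1 + e * m)%N by rewrite (leq_trans le_em) ?leq_addl.
  apply: pmod; rewrite ?(leq_trans le_m) ?leq_addr //.
  by rewrite -[RHS]modnDmr modnMr addn0.
have [|k k_gt0 per_k] := @finite_square_factor P (phi w) (phi (a, sgpow v (e * m)))
  (phi (b, sgpow v ((2 * e).-1 + e * m))) finP.
  by rewrite -!gmulfM -eq_w.
(* This exponent is 1 modulo [k], which leaves [phi w] unchanged, and 1 modulo [e], which makes the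
   powers of [t] and [v] agree. *)
apply: sep; exists (sgpow (u, v) (1 + e * m * k)); first by exists (1 + e * m * k)%N.
rewrite -[RHS](sgpow_periodD (e * m) (m := 1) (a := 1) _ per_k) //.
rewrite -gmulf_sgpow; congr (phi _); rewrite !sgpow_pair; congr pair.
have le_K : (m <= 1 + e * m * k)%N.
  by rewrite (leq_trans le_em) // (leq_trans _ (leq_addl _ _)) // leq_pmulr.
rewrite sgpowM //; apply: pmod => //; first by rewrite mulSn (leq_trans le_K) ?leq_addr.
by rewrite mulSn -[(e * m * (1 + _))%N]mulnA -[RHS]modnDmr modnMr addn0.
Qed.

Theorem theorem5p10 (T : semigroupType) :
  [set: T] !=set0 -> residually_finite T -> periodic T ->
  (monogenic_separability_preserving T <-> union_of_groups T).
Proof.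
move=> _ rfT perT; split; first exact: preserving_union_of_groups.
exact: union_of_groups_preserving.
Qed.
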